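(* Let $q\geq 2$ be an integer and let $\alpha$ be a positive irrational real number. Then \[ \limsup_{n\to\infty}\frac{s_q(\lfloor n^{\alpha}\rfloor)}{s_q(n)}=\infty. \]
   Context: For an integer $q\geq 2$ and $n\in\mathbb{N}$, $s_q(n)$ denotes the sum of the digits of $n$ written in base $q$. $\lfloor x\rfloor$ is the floor of $x$. *)

(* Defs.v *)
From HB Require Import structures.
From mathcomp Require Export all_boot all_order all_algebra.
From mathcomp Require Export all_classical all_reals all_analysis.
Export Order.TTheory GRing.Theory Num.Theory.
Export numFieldNormedType.Exports.

Set Implicit Arguments.
Unset Strict Implicit.
Unset Printing Implicit Defensive.

(* For 1 < q, the base-q expansion of n > 0 has trunc_log q n + 1 digits, the
   i-th one (from the least significant) being (n %/ q ^ i) %% q; the number 0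
   gets the single digit 0. *)
Definition sum_digits (q n : nat) : nat :=
  (\sum_(i < (trunc_log q n).+1) (n %/ q ^ i) %% q)%N.

(* Main.v *)
Require Import Defs.
From mathcomp Require Import zify ring lra.

Local Open Scope ring_scope.

(* Take n = q ^ k, whose digit sum is 1.  The fractional parts of k * alpha
   come arbitrarily close to 1 from below for infinitely many k; for such k the
   number n ^ alpha = q ^ (k * alpha) lies just below a power of q, so its
   integer part starts with as many digits q - 1 as desired. *)

Lemma sum_digits_expn (q k : nat) : (1 < q)%N -> sum_digits q (q ^ k) = 1%N.
Proof.
move=> q_gt1; have q_gt0 : (0 < q)%N by exact: ltnW.
rewrite /sum_digits trunc_expnK// big_ord_recr/= divnn expn_gt0 q_gt0/=.
rewrite (modn_small q_gt1) big1// => i _.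
by rewrite -expnB ?(ltnW (ltn_ord i))// -(subnSK (ltn_ord i)) expnS modnMr.
Qed.

(** The bounds force the top [l] of the [m] digits of [n] to equal [q - 1], so each of them
    contributes at least 1. *)
Lemma leq_sum_digits (q l m n : nat) : (1 < q)%N -> (l <= m)%N ->
  (q ^ m - q ^ (m - l) <= n < q ^ m)%N -> (l <= sum_digits q n)%N.
Proof.
case: l => [//|l] q_gt1 lm /andP[le_n lt_n].
have q_gt0 : (0 < q)%N by exact: ltnW.
case: m lm le_n lt_n => [//|m] lm le_n lt_n.
have log_n : trunc_log q n = m.
  apply: trunc_log_eq => //; rewrite lt_n andbT; apply: leq_trans le_n.
  have le_m : (q ^ (m.+1 - l.+1) <= q ^ m)%N.
    by rewrite leq_exp2l// subSS leq_subr.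
  apply: leq_trans (leq_sub2l _ le_m).
  by rewrite expnS -[X in (_ - X)%N]mul1n -mulnBl leq_pmull// subn_gt0.
(* The boolean, read as 0 or 1, marks the leading positions; summing it over [i] counts them. *)
have digit (i : 'I_m.+1) :
    ((m - l <= i) <= (n %/ q ^ i) %% q)%N.
  case: (leqP (m - l) i) => //= il; have im := ltn_ord i.
  have split_i : (q ^ m.+1 = q ^ (m.+1 - i) * q ^ i)%N.
    by rewrite -expnD subnK// ltnW.
  have le_i : (q ^ (m.+1 - l.+1) <= q ^ i)%N by rewrite leq_exp2l.
  have qi_gt0 : (0 < q ^ i)%N by rewrite expn_gt0 q_gt0.
  (* Dropping the [i] lowest digits leaves a number written with digits [q - 1] only. *)
  have : (n %/ q ^ i = (q ^ (m.+1 - i)).-1)%N.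
    apply/eqP; rewrite eqn_leq leq_divRL// -ltnS prednK ?expn_gt0 ?q_gt0//.
    rewrite ltn_divLR// -split_i lt_n/= -subn1 mulnBl mul1n -split_i.
    by apply: leq_trans le_n; rewrite leq_sub2l.
  rewrite subSn// expnS => ->; set b := (q ^ (m - i))%N.
  have b_gt0 : (0 < b)%N by rewrite expn_gt0 q_gt0.
  have -> : ((q * b).-1 = b.-1 * q + q.-1)%N by nia.
  by rewrite modnMDl modn_small; lia.
rewrite /sum_digits log_n; apply: leq_trans (leq_sum _ (fun i _ => digit i)).
rewrite -(big_mkord xpredT (fun i => (m - l <= i)%N : nat)).
rewrite (@big_cat_nat _ _ _ (m - l)%N) ?leqW ?leq_subr//=.
apply: leq_trans (leq_addl _ _).
rewrite (eq_big_nat _ _ (F2 := fun=> 1%N)) => [|i /andP[-> _]//].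
by rewrite sum_nat_const_nat; lia.
Qed.

Section Approximation.
Variable R : realType.
Implicit Types (x y d : R) (k m n : nat).

Lemma irrational_mulrn x k : (0 < k)%N -> irrational x ->
  irrational (k%:R * x).
Proof.
move=> k_gt0 xI [r _ rE]; apply: xI; exists (k%:R^-1 * r) => //.
rewrite rmorphM fmorphV/= rE rmorph_nat mulKf// pnatr_eq0.
by case: k k_gt0 {rE}.
Qed.

Lemma irrational_neq_nat x m : irrational x -> x != m%:R.
Proof.
move=> xI; apply/eqP => xE; apply: xI; exists m%:R => //.
by rewrite rmorph_nat.
Qed.

(** Pigeonhole: among the fractional parts of [i * x] for [i <= n.+1], two share one of the [n.+1]
    boxes of width [n.+1%:R^-1]; subtract the two multiples. *)
Lemma dirichlet_approximation x n : 0 <= x ->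
  exists k m, (0 < k)%N /\ `|k%:R * x - m%:R| < n.+1%:R^-1.
Proof.
move=> x_ge0; pose fl k := Num.truncn (k%:R * x).
pose fr k := k%:R * x - (fl k)%:R.
have flP k : (fl k)%:R <= k%:R * x < (fl k).+1%:R.
  by apply: truncn_itv; rewrite mulr_ge0.
have fr_ge0 k : 0 <= fr k by rewrite subr_ge0; case/andP: (flP k).
have fr_lt1 k : fr k < 1.
  by rewrite ltrBlDl natr1; case/andP: (flP k).
have boxP k : (Num.truncn (n.+1%:R * fr k))%:R <= n.+1%:R * fr k
    < (Num.truncn (n.+1%:R * fr k)).+1%:R.
  by apply: truncn_itv; rewrite mulr_ge0.
have box_lt k : (Num.truncn (n.+1%:R * fr k) < n.+1)%N.
  rewrite -(ltr_nat R); case/andP: (boxP k) => /le_lt_trans + _; apply.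
  by rewrite gtr_pMr.
pose box (i : 'I_n.+2) := Ordinal (box_lt i).
have /injectivePn[i [j + boxij]] : ~~ injectiveb box.
  apply/negP => /injectiveP/leq_card; by rewrite !card_ord ltnn.
wlog ij : i j boxij / (i < j)%N => [th|_].
  move=> ij; have := ij; rewrite -val_eqE neq_ltn => /orP[|] /th; apply=> //.
  by rewrite eq_sym.
have flij : (fl i <= fl j)%N by rewrite le_truncn// ler_wpM2r// ler_nat ltnW.
exists (j - i)%N, (fl j - fl i)%N; split; first by rewrite subn_gt0.
have -> : (j - i)%:R * x - (fl j - fl i)%:R = fr j - fr i.
  by rewrite !natrB ?(ltnW ij)// /fr; ring.
have bE : Num.truncn (n.+1%:R * fr i) = Num.truncn (n.+1%:R * fr j).
  by move/(congr1 val): boxij.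
have n_gt0 : 0 < n.+1%:R :> R by [].
rewrite -(ltr_pM2l n_gt0) divff ?gt_eqF// -[X in X * _]gtr0_norm// -normrM.
move: (boxP i) (boxP j); rewrite bE ltr_norml [_ * (fr j - fr i)]mulrBr.
move: (Num.truncn _) => t; rewrite -(natr1 t).
by move=> /andP[? ?] /andP[? ?]; apply/andP; split; lra.
Qed.

(** Dirichlet's bound leaves the sign of the error open. Irrationality rules out zero, a negative
    error is what is wanted, and a positive one is repeated until it almost fills a unit. *)
Lemma nat_multiple_lt_near x d : 0 <= x -> irrational x -> 0 < d ->
  exists k m, (0 < k)%N /\ m%:R - d < k%:R * x < m%:R.
Proof.
move=> x_ge0 xI d_gt0; pose n := Num.truncn d^-1.
have n_d : n.+1%:R^-1 < d.
  by rewrite invf_plt ?posrE// truncnS_gt.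
have [k [m [k_gt0 km]]] := dirichlet_approximation _ n x_ge0.
set e := k%:R * x - m%:R in km.
have kxE : k%:R * x = m%:R + e by rewrite /e; ring.
have e_lt1 : `|e| < 1.
  by apply: lt_le_trans km _; rewrite invf_le1// ler1n.
have {km n_d} e_ltd : `|e| < d by exact: lt_trans km n_d.
have : e != 0 by rewrite subr_eq0 irrational_neq_nat//; exact: irrational_mulrn.
rewrite neq_lt => /orP[e_lt0|e_gt0].
  exists k, m; split=> //; rewrite kxE; clearbody e.
  by move: e_ltd; rewrite ltr0_norm// => ?; apply/andP; split; lra.
(* Here k * x exceeds m by e; a multiple of e lies in the window ]1 - e, 1[. *)
rewrite gtr0_norm// in e_ltd e_lt1.
pose j := Num.truncn e^-1.
have /andP[j_le j_gt] : j%:R <= e^-1 < j.+1%:R.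
  by apply: truncn_itv; rewrite invr_ge0 ltW.
have j_gt0 : (0 < j)%N.
  by rewrite truncn_gt0 invf_ge1 // ltW.
have je_le : j%:R * e <= 1 by rewrite -ler_pdivlMr// mul1r.
have je_gt : 1 < j%:R * e + e.
  by move: j_gt; rewrite -div1r ltr_pdivrMr// -natr1 mulrDl mul1r.
have jkxE : (j * k)%:R * x = (j * m)%:R + j%:R * e.
  by rewrite !natrM -mulrA kxE; ring.
(* Equality would make [(j * k)%:R * x] the natural number [(j * m).+1]. *)
have : j%:R * e != 1.
  apply/eqP => je1; have := irrational_neq_nat _ (j * m).+1
    (irrational_mulrn _ (j * k) _ xI).
  by rewrite muln_gt0 j_gt0 k_gt0 jkxE je1 natr1 eqxx => /(_ isT).
rewrite neq_lt [1 < _]ltNge je_le orbF => je_lt.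
exists (j * k)%N, (j * m).+1; rewrite muln_gt0 j_gt0 k_gt0; split=> //.
by rewrite jkxE -natr1; apply/andP; split; lra.
Qed.

(** The window for [y] comes from [1 + t <= expR t] at [t = (y - m%:R) * ln b], which exceeds
    [- b ^- l]. *)
Lemma powR_just_below_expr (b y : R) l m : 1 < b -> (l <= m)%N ->
  m%:R - b ^- l / ln b < y < m%:R ->
  b ^+ m - b ^+ (m - l) <= b `^ y < b ^+ m.
Proof.
move=> b_gt1 lm /andP[y_gt y_lt].
have b_gt0 : 0 < b by lra.
have lnb_gt0 : 0 < ln b by exact: ln_gt0.
have bmE : b ^+ m = expR (m%:R * ln b).
  by rewrite expRM_natl lnK// posrE.
rewrite [in _ < b ^+ m]bmE /powR gt_eqF// ltr_expR ltr_pM2r// y_lt andbT.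
have -> : b ^+ m - b ^+ (m - l) = b ^+ m * (1 - b ^- l).
  by rewrite mulrBr mulr1 expfB_cond// gt_eqF.
have -> : y * ln b = m%:R * ln b + (y - m%:R) * ln b by ring.
rewrite expRD -bmE ler_pM2l ?exprn_gt0//.
apply: le_trans (expR_ge1Dx _); rewrite lerD2l.
have : - (b ^- l / ln b) < y - m%:R by lra.
by rewrite -(ltr_pM2r lnb_gt0) mulNr divfK ?gt_eqF// => /ltW.
Qed.

Lemma limn_esup_pinfty (u : R^nat) :
  (forall (a : R) N, exists2 n, (N <= n)%N & a <= u n) ->
  limn_esup (EFin \o u) = +oo%E.
Proof.
move=> u_unbounded; apply/eqP; rewrite eq_le leey/= /limn_esup limf_esupE.
apply: le_ereal_inf_tmp => _ [V [N _ NV] <-].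
rewrite leNgt; apply/negP => sup_lt.
(* A finite supremum would be exceeded by a term at least 1 above it; an infinite one is excluded by
   [un] or [sup_lt]. *)
have [n Nn] := u_unbounded (fine (ereal_sup ((EFin \o u) @` V)) + 1) N.
have un : ((u n)%:E <= ereal_sup ((EFin \o u) @` V))%E.
  by apply: ereal_sup_ubound; exists n => //; exact: NV.
move: un sup_lt; case: ereal_sup => //= s; rewrite lee_fin => un _ /le_trans.
by move=> /(_ _ un); rewrite leNgt ltrDl ltr01.
Qed.

End Approximation.

(* The term at n = 0, where the denominator vanishes, has no effect on the
   limit superior. *)
Theorem theorem4p2 (R : realType) (q : nat) (alpha : R)
    (hq : (2 <= q)%N) (halpha_pos : 0 < alpha)
    (halpha_irr : irrational alpha) :
  limn_esup (fun n : nat =>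
    ((sum_digits q `|Num.floor (n%:R `^ alpha)|%N)%:R
       / (sum_digits q n)%:R : R)%:E) = +oo%E.
Proof.
apply: limn_esup_pinfty => a N.
(* [l] exceeds [a], and [K] exceeds both [N] and [l / alpha]: the latter gives [l <= m], so that
   there is room for [l] leading digits. *)
pose l := (Num.truncn a).+1.
pose K := (maxn N (Num.truncn (l%:R / alpha))).+1.
have q_gt1 : 1 < q%:R :> R by rewrite ltr1n.
have d_gt0 : 0 < (q%:R : R) ^- l / ln q%:R.
  by rewrite divr_gt0 ?invr_gt0 ?exprn_gt0 ?ln_gt0//; lra.
have K_gt0 : (0 < K)%N by [].
(* Approximating by multiples of K * alpha forces the exponent to be large. *)
have [|k [m [k_gt0]]] := nat_multiple_lt_near
  _ _ _ _ (irrational_mulrn _ _ _ K_gt0 halpha_irr) d_gt0;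
  first by rewrite mulr_ge0// ltW.
rewrite mulrA -natrM => kKm.
have K_le : (K <= k * K)%N by rewrite leq_pmull.
have l_lt : l%:R < (k * K)%:R * alpha.
  rewrite -ltr_pdivrMr//; apply: lt_le_trans (truncnS_gt _) _.
  by rewrite ler_nat (leq_trans _ K_le)// ltnS leq_maxr.
have lm : (l <= m)%N.
  by rewrite ltnW// -(ltr_nat R); case/andP: kKm => _; exact: lt_trans.
exists (q ^ (k * K))%N.
  apply: (@leq_trans K); first by rewrite ltnW// ltnS leq_maxl.
  by apply: leq_trans K_le _; rewrite ltnW// ltn_expl.
rewrite sum_digits_expn// divr1 natrX -powR_mulrn// -powRrM.
set y := _ `^ _; have y_ge0 : 0 <= y by exact: powR_ge0.
have /andP[le_y lt_y] := powR_just_below_expr _ _ _ _ _ q_gt1 lm kKm.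
apply: (@le_trans _ _ l%:R); first by rewrite ltW// truncnS_gt.
rewrite ler_nat; apply: (leq_sum_digits _ _ m) => //.
have := truncn_floor y; rewrite y_ge0 => <-.
rewrite truncn_ge_nat// truncn_lt_nat// natrB ?leq_exp2l ?leq_subr// !natrX.
by rewrite le_y lt_y.
Qed.
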